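(* (i) Let $J\subseteq\mathbb{R}$ be an open interval and let $h:J\to J$ be a (continuous) involution. Define $k:J\to\mathbb{R}$ by $k(x):=x-h(x)$. Then $k$ is a homeomorphism of $J$ onto a symmetric open interval $I=k(J)$, and the function $P:I\to\mathbb{R}$ defined by $P(y)=2k^{-1}(y)-y$ satisfies $P(0)=0$ and is even. (ii) Vice versa, let $I\subseteq\mathbb{R}$ be a symmetric open interval and let $P:I\to\mathbb{R}$ be a continuous even function with $P(0)=0$ such that the function $$K(y)=\frac12\bigl(y+P(y)\bigr),\qquad y\in I,$$ is a homeomorphism of $I$ onto some $J\subseteq\mathbb{R}$. Let $k:=K^{-1}:J\to I$. Then $h(x):=x-k(x)$, $x\in J$, is an involution on $J$.
   Context: An involution on an open interval $J\subseteq\mathbb{R}$ is a continuous function $h$ of $J$ onto itself such that $h^{-1}=h$ (i.e. $h(h(x))=x$ for all $x\in J$), $0\in J$, $h(0)=0$, and $h\neq \mathrm{id}_J$ (the identity function of $J$). An open interval $I\subseteq\mathbb{R}$ is called symmetric if it is nonempty and symmetric with respect to $0$, i.e. $y\in I$ implies $-y\in I$. A function $P$ on a symmetric interval $I$ is even if $P(-y)=P(y)$ for all $y\in I$. *)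

(* Defs.v *)
From HB Require Import structures.
From mathcomp Require Import all_boot all_order all_algebra.
From mathcomp Require Import all_classical all_reals all_analysis.

Set Implicit Arguments.
Unset Strict Implicit.
Unset Printing Implicit Defensive.

Import Order.TTheory GRing.Theory Num.Theory.
Import numFieldNormedType.Exports.

Local Open Scope classical_set_scope.
Local Open Scope ring_scope.

(* A function defined on a set A of reals is represented by a total function
   R -> R of which only the restriction to A is constrained; its inverse is
   [pinv A f], meaningful on f @` A only. *)

Definition open_interval (R : realType) (J : set R) : Prop :=
  is_interval J /\ open J.

Definition symmetric_open_interval (R : realType) (I : set R) : Prop :=
  [/\ open_interval I, I !=set0 & forall y, I y -> I (- y)].

Definition even_on (R : realType) (I : set R) (P : R -> R) : Prop :=
  forall y, I y -> P (- y) = P y.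

Definition homeomorphism_on (R : realType) (A B : set R) (f : R -> R) : Prop :=
  [/\ set_bij A B f, {within A, continuous f} &
      {within B, continuous (pinv A f)}].

Record involution_on (R : realType) (J : set R) (h : R -> R) : Prop := {
  involution_dom : open_interval J;
  involution_continuous : {within J, continuous h};
  involution_onto : h @` J = J;
  involution_cancel : forall x, J x -> h (h x) = x;
  involution_mem0 : J 0;
  involution_fix0 : h 0 = 0;
  involution_neq_id : ~ (forall x, J x -> h x = x)
}.

(* Main.v *)
Require Import Defs.
From HB Require Import structures.
From mathcomp Require Import all_boot all_order all_algebra.
From mathcomp Require Import ring.
From mathcomp Require Import all_classical all_reals all_analysis.

Set Implicit Arguments.
Unset Strict Implicit.
Unset Printing Implicit Defensive.

Import Order.TTheory GRing.Theory Num.Theory.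
Import numFieldNormedType.Exports.

Local Open Scope classical_set_scope.
Local Open Scope ring_scope.

(** Both directions rest on one observation: the reflection [y |-> - y] of
    [I] and the involution [h] of [J] are the same map seen in the coordinate
    [k = id - h].

    (i) Since [h (h x) = x], replacing [x] by [h x] changes the sign of [k x]
    and leaves the sum [x + h x] unchanged.  The sign change makes
    [I = k @` J] symmetric, and [P (k x) = 2 x - k x = x + h x], so [P] is
    even.  What remains is topological.  An involution other than the identity
    is strictly decreasing ([involution_decreasing]), so [k] is strictly
    increasing, hence injective; and a continuous injection of an open set of
    reals is open with continuous inverse ([image_open_continuous_inj],
    [continuous_pinv_open]).

    (ii) If [x = K y], then [x - k x = K y - y = (P y - y) / 2 = K (- y)] by
    evenness.  So [id - k] is [y |-> - y] conjugated by the homeomorphism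
    [K]: it is an involution, it fixes [0 = K 0], and it is not the identity
    because the open set [I] is not reduced to [0]. *)

(** * Continuous injections of open sets of reals *)

(** Injectivity near [x] turns [pinv A f] into a local inverse of [f], so both
    conclusions come from the local inverse theorem for continuous real
    functions; the first says that the local inverse lands in [A], which is
    what makes [f @` A] a neighbourhood of [f x]. *)
Lemma near_pinv_continuous_inj (R : realType) (A : set R) (f : R -> R) (x : R) :
  open A -> {within A, continuous f} -> {in A &, injective f} -> A x ->
  nbhs (f x) (f @` A) /\ {for f x, continuous (pinv A f)}.
Proof.
move=> oA cf fI Ax.
have Anear : nbhs x A by exact: open_nbhs_nbhs.
have fK : {near x, cancel f (pinv A f)}.
  by apply: filterS Anear => y Ay; apply: pinvKV => //; exact/mem_set.
have cfx : {near x, continuous f}.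
  move: cf; rewrite continuous_open_subspace// => cf.
  by apply: filterS Anear => y Ay; apply: cf; exact/mem_set.
have [cg gK] := near_can_continuousAcan_sym fK cfx.
have cgx : {for f x, continuous (pinv A f)} by exact: nbhs_singleton cg.
split=> //.
have gA : nbhs (f x) (pinv A f @^-1` A).
  by apply: cgx; rewrite (nbhs_singleton fK).
by apply: filterS2 gA gK => y Agy gKy; exists (pinv A f y).
Qed.

Lemma image_open_continuous_inj (R : realType) (A : set R) (f : R -> R) :
  open A -> {within A, continuous f} -> {in A &, injective f} ->
  open (f @` A).
Proof.
move=> oA cf fI; rewrite openE => _ [x Ax <-].
by have [] := near_pinv_continuous_inj oA cf fI Ax.
Qed.

Lemma continuous_pinv_open (R : realType) (A : set R) (f : R -> R) :
  open A -> {within A, continuous f} -> {in A &, injective f} ->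
  {within f @` A, continuous (pinv A f)}.
Proof.
move=> oA cf fI; apply: continuous_in_subspaceT => _ /set_mem[x Ax <-].
by have [] := near_pinv_continuous_inj oA cf fI Ax.
Qed.

Lemma is_interval_continuous_image (R : realType) (A : set R) (f : R -> R) :
  is_interval A -> {within A, continuous f} -> is_interval (f @` A).
Proof.
move=> /connected_intervalP cA cf; apply/connected_intervalP.
exact: connected_continuous_connected.
Qed.

Lemma open_interval_continuous_inj (R : realType) (A : set R) (f : R -> R) :
  open_interval A -> {within A, continuous f} -> {in A &, injective f} ->
  open_interval (f @` A).
Proof.
move=> [iA oA] cf fI; split; first exact: is_interval_continuous_image.
exact: image_open_continuous_inj.
Qed.

Lemma homeomorphism_on_image (R : realType) (A : set R) (f : R -> R) :
  open A -> {within A, continuous f} -> {in A &, injective f} ->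
  homeomorphism_on A (f @` A) f.
Proof.
move=> oA cf fI; split=> //; last exact: continuous_pinv_open.
by split=> // x Ax; exists x.
Qed.

(** * Involutions of an open interval *)

Lemma involution_stable (R : realType) (J : set R) (h : R -> R) (x : R) :
  involution_on J h -> J x -> J (h x).
Proof. by move=> hJ Jx; rewrite -(involution_onto hJ); exists x. Qed.

Lemma involution_inj (R : realType) (J : set R) (h : R -> R) :
  involution_on J h -> {in J &, injective h}.
Proof.
move=> hJ x y /set_mem Jx /set_mem Jy /(congr1 h).
by rewrite !(involution_cancel hJ).
Qed.

(** Being continuous and injective, [h] is strictly monotone.  It cannot be
    increasing: [x < h x] would give [h x < h (h x) = x], and likewise for
    [h x < x], so [h] would be the identity. *)
Lemma involution_decreasing (R : realType) (J : set R) (h : R -> R) (x y : R) :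
  involution_on J h -> J x -> J y -> x < y -> h y < h x.
Proof.
move=> hJ Jx Jy xy.
have /is_intervalP JE := (involution_dom hJ).1.
have inJ z : J z -> z \in Rhull J by rewrite {1}JE.
have Jin z : z \in Rhull J -> J z by move=> zJ; rewrite JE.
have ch : {within [set` Rhull J], continuous h}.
  by rewrite -JE; exact: involution_continuous hJ.
have hI : {in Rhull J &, injective h}.
  by move=> u v /Jin/mem_set Ju /Jin/mem_set Jv; exact: (involution_inj hJ).
have [hinc|] := itv_continuous_inj_mono ch hI; last first.
  by apply=> //; exact: inJ.
case: (involution_neq_id hJ) => z Jz.
have Jhz := involution_stable hJ Jz.
have [hz|hz|//] := ltgtP (h z) z.
  have := hinc _ _ (inJ _ Jhz) (inJ _ Jz) hz.
  by rewrite (involution_cancel hJ Jz) ltNge (ltW hz).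
have := hinc _ _ (inJ _ Jz) (inJ _ Jhz) hz.
by rewrite (involution_cancel hJ Jz) ltNge (ltW hz).
Qed.

Lemma displacement_inj (R : realType) (J : set R) (h : R -> R) :
  involution_on J h -> {in J &, injective (fun x => x - h x)}.
Proof.
move=> hJ.
have kinc x y : J x -> J y -> x < y -> x - h x < y - h y.
  by move=> Jx Jy xy; apply: ltrD => //; rewrite ltrN2 (involution_decreasing hJ).
move=> x y /set_mem Jx /set_mem Jy /= kxy.
by have [xy|xy|//] := ltgtP x y;
  [have := kinc _ _ Jx Jy xy|have := kinc _ _ Jy Jx xy]; rewrite kxy ltxx.
Qed.

Lemma displacement_continuous (R : realType) (J : set R) (h : R -> R) :
  {within J, continuous h} -> {within J, continuous (fun x => x - h x)}.
Proof.
move=> ch x; apply: continuousB; last exact: ch.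
by apply: continuous_subspaceT => y; exact: cvg_id.
Qed.

Lemma involution_even (R : realType) (J : set R) (h : R -> R) :
  involution_on J h ->
  let k := fun x : R => x - h x in
  let I := k @` J in
  let P := fun y : R => 2 * pinv J k y - y in
  [/\ symmetric_open_interval I, homeomorphism_on J I k, P 0 = 0
    & even_on I P].
Proof.
move=> hJ k I P.
have kI : {in J &, injective k} := displacement_inj hJ.
have ck : {within J, continuous k}.
  exact: displacement_continuous (involution_continuous hJ).
have Pk x : J x -> P (k x) = x + h x.
  by move=> Jx; rewrite /P pinvKV ?inE// /k; ring.
have kh x : J x -> k (h x) = - k x.
  by move=> Jx; rewrite /k (involution_cancel hJ Jx) opprB.
have J0 := involution_mem0 hJ.
have k0 : k 0 = 0 by rewrite /k (involution_fix0 hJ) subr0.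
have oJ := involution_dom hJ.
split.
- split; first exact: open_interval_continuous_inj.
    by exists (k 0); exists 0.
  move=> _ [x Jx <-]; rewrite -kh//.
  by exists (h x) => //; exact: involution_stable hJ Jx.
- by apply: homeomorphism_on_image => //; case: oJ.
- by rewrite -k0 Pk// (involution_fix0 hJ) addr0.
- move=> _ [x Jx <-]; have Jhx := involution_stable hJ Jx.
  by rewrite -kh// !Pk// (involution_cancel hJ Jx) addrC.
Qed.

(** * Involutions from even functions *)

Lemma symmetric_open_interval0 (R : realType) (I : set R) :
  symmetric_open_interval I -> I 0.
Proof.
move=> [[iI _] [y Iy] sI]; have INy := sI _ Iy.
have [y0|y0] := leP 0 y.
  by apply: (iI _ _ INy Iy); rewrite y0 oppr_le0 y0.
by apply: (iI _ _ Iy INy); rewrite (ltW y0) oppr_ge0 (ltW y0).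
Qed.

Lemma open_neq0 (R : realType) (I : set R) :
  open I -> I 0 -> exists2 y, I y & y != 0.
Proof.
move=> oI I0.
have /nbhs_ballP[e /= e0 eI] : nbhs 0 I by exact: open_nbhs_nbhs.
exists (e / 2); last by rewrite gt_eqF// divr_gt0.
apply: eI; rewrite /ball /= sub0r normrN gtr0_norm ?divr_gt0//.
by rewrite ltr_pdivrMr// ltr_pMr// ltr1n.
Qed.

Lemma even_involution (R : realType) (I J : set R) (P : R -> R) :
  symmetric_open_interval I -> even_on I P -> P 0 = 0 ->
  let K := fun y : R => 2^-1 * (y + P y) in
  homeomorphism_on I J K ->
  involution_on J (fun x : R => x - pinv I K x).
Proof.
move=> symI evP P0 K [[KJ KI KS] cK ck].
have I0 := symmetric_open_interval0 symI.
have [[iI oI] _ sI] := symI.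
have JE : K @` I = J.
  by apply/seteqP; split=> // _ [y Iy <-]; exact: KJ.
have KK y : I y -> pinv I K (K y) = y by move=> Iy; rewrite pinvKV ?inE.
have hK y : I y -> K y - pinv I K (K y) = K (- y).
  by move=> Iy; rewrite KK// /K evP//; field.
have K0 : K 0 = 0 by rewrite /K P0 addr0 mulr0.
split.
- by rewrite -JE; exact: open_interval_continuous_inj.
- exact: displacement_continuous.
- rewrite -JE; apply/seteqP; split=> [_ [_ [y Iy <-] <-]|_ [y Iy <-]].
    by rewrite hK//; exists (- y) => //; exact: sI.
  have INy := sI _ Iy.
  by exists (K (- y)); [exists (- y)|rewrite hK// opprK].
- rewrite -JE => _ [y Iy <-]; have INy := sI _ Iy.
  by rewrite (hK y)// hK// opprK.
- by rewrite -JE; exists 0.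
- by rewrite -{1 2}K0 hK// oppr0.
- move=> hid; have [y Iy /eqP[]] := open_neq0 oI I0.
  (* [K y] is a fixed point, i.e. [K y - y = K y] *)
  have /hid : J (K y) by rewrite -JE; exists y.
  by rewrite KK// -[RHS]subr0 => /addrI/oppr_inj.
Qed.

Theorem theorem2p1 (R : realType) :
  (forall (J : set R) (h : R -> R),
    open_interval J -> involution_on J h ->
    let k := fun x : R => x - h x in
    let I := k @` J in
    let P := fun y : R => 2 * pinv J k y - y in
    [/\ symmetric_open_interval I, homeomorphism_on J I k, P 0 = 0
      & even_on I P])
  /\
  (forall (I J : set R) (P : R -> R),
    symmetric_open_interval I ->
    {within I, continuous P} -> even_on I P -> P 0 = 0 ->
    let K := fun y : R => 2^-1 * (y + P y) in
    homeomorphism_on I J K ->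
    let k := pinv I K in
    involution_on J (fun x : R => x - k x)).
Proof.
split=> [J h _|I J P symI _]; first exact: involution_even.
exact: even_involution.
Qed.
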